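(* Let $E$ be a real Banach space of dimension at least $2$ and let $G\subsetneq E$ be a domain. Then $G$ is $c$-uniform for some $c\ge 1$ if and only if $G$ is diameter $c_1$-uniform for some $c_1\ge1$ and $\psi$-natural for some increasing function $\psi:[0,\infty)\to[0,\infty)$.
   Context: A domain is a nonempty connected open set; the norm of $E$ is written $|\cdot|$; $\partial G$ is the norm boundary and $d_G(x)=\operatorname{dist}(x,\partial G)$ for $x\in G$. For an arc $\gamma$ and $x,z\in\gamma$, $\gamma[x,z]$ is the subarc between $x$ and $z$, and $\ell(\gamma)$ is the norm length. $c$-uniform ($c\ge1$): each pair of points $x,y\in G$ can be connected by an arc $\gamma$ in $G$ with $\ell(\gamma)\le c|x-y|$ and $\min\{\ell(\gamma[x,z]),\ell(\gamma[z,y])\}\le c\,d_G(z)$ for all $z\in\gamma$. Diameter $c$-uniform ($c\ge1$): each pair of points $x_1,x_2\in G$ can be joined by an arc $\alpha$ in $G$ with $\operatorname{diam}\alpha\le c|x_1-x_2|$ and $\min_{j=1,2}\operatorname{diam}(\alpha[x_j,x])\le c\,d_G(x)$ for all $x\in\alpha$. Quasihyperbolic metric: $k_G(x,y)=\inf\int_\alpha\frac{|dz|}{d_G(z)}$, the infimum over all rectifiable curves $\alpha$ in $G$ joining $x$ and $y$. Put $r_G(x,y)=\frac{|x-y|}{\min\{d_G(x),d_G(y)\}}$ and, for nonempty $A\subseteq G$, $r_G(A)=\sup_{x,y\in A}r_G(x,y)$ and $k_G(A)=\sup_{x,y\in A}k_G(x,y)$. $\psi$-natural: for an increasing function $\psi:[0,\infty)\to[0,\infty)$,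 $G$ is $\psi$-natural if $k_G(A)\le\psi(r_G(A))$ for every nonempty connected set $A\subseteq G$ with $r_G(A)<\infty$. *)

(* Defs.v *)
From HB Require Import structures.
From mathcomp Require Import all_boot all_order all_algebra.
From mathcomp Require Import all_classical all_reals all_analysis.

Set Implicit Arguments.
Unset Strict Implicit.
Unset Printing Implicit Defensive.

Import Order.TTheory GRing.Theory Num.Theory.
Import numFieldNormedType.Exports.

Local Open Scope classical_set_scope.
Local Open Scope ring_scope.

Definition dim_ge2 (R : realType) (E : normedModType R) : Prop :=
  exists u v : E, forall a b : R, a *: u + b *: v = 0 -> a = 0 /\ b = 0.

Definition is_domain (T : topologicalType) (G : set T) : Prop :=
  [/\ G !=set0, connected G & open G].

Definition boundary (T : topologicalType) (G : set T) : set T :=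
  closure G `\` interior G.

Section Curves.
Context {R : realType} {E : normedModType R}.
Implicit Types (a b t : R) (g : R -> E) (x y : E) (A G : set E).

Definition diam A : \bar R :=
  ereal_sup [set `|z.1 - z.2|%:E | z in A `*` A].

(* A curve is a map [g : R -> E] considered on [[a, b]] only; the case [a = b]
   (a one-point curve) is allowed. *)
Definition is_curve a b g : Prop := a <= b /\ {within `[a, b], continuous g}.

(* On the compact [[a, b]] a continuous injection is a homeomorphism onto its
   image. For [a <= t <= b], the subarc between [g a] and [g t] is [g] on
   [[a, t]]. A one-point arc joins a point to itself. *)
Definition is_arc a b g : Prop := is_curve a b g /\ {in `[a, b] &, injective g}.

Definition joins_in G a b g x y : Prop :=
  [/\ g a = x, g b = y & g @` `[a, b] `<=` G].

(* A partition [s] with [itv_partition a b s] lists the points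
   [a < s_0 < ... < b], without [a] and ending in [b]. This is
   [total_variation a b g], which the library has for real-valued [g] only. *)
Definition curve_length a b g : \bar R :=
  ereal_sup [set (\sum_(0 <= n < size s)
                    `|g (nth b (a :: s) n.+1) - g (nth b (a :: s) n)|)%:E
            | s in [set s | itv_partition a b s]].

Definition rectifiable a b g : Prop := (curve_length a b g < +oo)%E.

(* Parametrization by arc length: a rectifiable [g] takes a single value on the set of those
   [t] for which [g] has length [u] on [[a, t]], so the choice of [t] is
   irrelevant for [0 <= u <= curve_length a b g]. *)
Definition arclength_param a b g (u : R) : E :=
  g (xget a [set t | t \in `[a, b] /\ curve_length a t g = u%:E]).

Definition line_integral a b g (f : E -> R) : \bar R :=
  (\int[lebesgue_measure]_(u in `[0%R, fine (curve_length a b g)])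
     (f (arclength_param a b g u))%:E)%E.

End Curves.

Section Domains.
Context {R : realType} {E : normedModType R}.
Implicit Types (c : R) (x y : E) (A G : set E).

Definition bdist G x : R := inf [set `|x - y| | y in boundary G].

Definition uniform_domain c G : Prop :=
  forall x y, G x -> G y ->
  exists (a b : R) (g : R -> E),
    [/\ is_arc a b g, joins_in G a b g x y,
        (curve_length a b g <= (c * `|x - y|)%:E)%E &
        forall t, t \in `[a, b] ->
          (mine (curve_length a t g) (curve_length t b g)
             <= (c * bdist G (g t))%:E)%E].

Definition diameter_uniform_domain c G : Prop :=
  forall x y, G x -> G y ->
  exists (a b : R) (g : R -> E),
    [/\ is_arc a b g, joins_in G a b g x y,
        (diam (g @` `[a, b]) <= (c * `|x - y|)%:E)%E &
        forall t, t \in `[a, b] ->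
          (mine (diam (g @` `[a, t])) (diam (g @` `[t, b]))
             <= (c * bdist G (g t))%:E)%E].

Definition qhyp G x y : \bar R :=
  ereal_inf [set l | exists (a b : R) (g : R -> E),
    [/\ is_curve a b g, rectifiable a b g, joins_in G a b g x y &
        l = line_integral a b g (fun z => (bdist G z)^-1)]].

Definition rdist G x y : R :=
  `|x - y| / Num.min (bdist G x) (bdist G y).

Definition qhyp_set G A : \bar R :=
  ereal_sup [set qhyp G z.1 z.2 | z in A `*` A].

Definition rdist_set G A : \bar R :=
  ereal_sup [set (rdist G z.1 z.2)%:E | z in A `*` A].

Definition natural_domain (psi : R -> R) G : Prop :=
  forall A, A !=set0 -> connected A -> A `<=` G ->
    (rdist_set G A < +oo)%E ->
    (qhyp_set G A <= (psi (fine (rdist_set G A)))%:E)%E.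

End Domains.

(* [psi] restricts to a (weakly) increasing function from [0, oo) to itself;
   its values at negative arguments are irrelevant. *)
Definition increasing_nonneg (R : realType) (psi : R -> R) : Prop :=
  (forall t : R, 0 <= t -> 0 <= psi t) /\
  (forall s t : R, 0 <= s -> s <= t -> psi s <= psi t).

(* Main.v *)
Require Import Defs.
From HB Require Import structures.
From mathcomp Require Import all_boot all_order all_algebra.
From mathcomp Require Import all_classical all_reals all_analysis.
From mathcomp Require Import measurable_realfun ring lra.

Set Implicit Arguments.
Unset Strict Implicit.
Unset Printing Implicit Defensive.

Import Order.TTheory GRing.Theory Num.Theory.
Import numFieldNormedType.Exports.

Local Open Scope classical_set_scope.
Local Open Scope ring_scope.

(** A uniform domain is diameter uniform because the diameter of an arc is at
    most its length.  It is natural because along a uniform arc from [x] to [y] the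
    distance to the boundary is at least [min (bdist x) (bdist y) / (2 c)].
    Together with the length bound [c * |x - y|] this gives
    [k(x, y) <= 2 c^2 r(x, y)]; the logarithmic bound of the classical theory is
    more than naturality asks for ([uniform_qhyp_le]).

    For the converse, take a diameter uniform arc from [x] to [y].  The diameter of
    its initial subarcs grows and that of its final subarcs shrinks, so there is a
    switching point before which the distance to the boundary controls the diameter
    back to [x], and after which it controls the diameter on to [y]
    ([switching_time]).  Consider the half ending at [x].  Its part between the
    spheres of radius [r / 2] and [r] around [x] is a connected set of diameter at
    most [2 r] at distance at least [r / (2 c)] from the boundary.  Naturality bounds
    its quasihyperbolic diameter by a constant.  A curve of bounded quasihyperbolic
    length can be replaced by a chain of boundedly many points, each within half a
    boundary distance of the next ([chain_of_integral]), so the two ends of the part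
    are joined by a polygon of length comparable to [r] whose distance to the
    boundary is also comparable to [r].  Halving [r] until [x] is reached by a single
    segment and summing the geometric series gives a polygon from the switching
    point to [x] on which the remaining length is controlled by the distance to the
    boundary ([tail_chain_to_endpoint]).

    The polygons to [x] and to [y] together satisfy the two conditions of
    uniformity, except that the resulting curve may cross itself.  Adding the
    segments one at a time and cutting at the last intersection point removes the
    loops ([extend_lipschitz_arc]).  Since this only shortens subarcs, the
    conditions persist ([arc_of_cigar_chain]).

    The lower bound for the quasihyperbolic length of a curve uses that the
    arc-length parametrization is 1-Lipschitz and defined on the whole interval
    ([arclength_surjective]), which rests on the additivity and the
    semicontinuity of length. *)

(** * Continuity on a segment in epsilon-delta form *)

Section Continuity.
Context {R : realType} {E : normedModType R}.
Implicit Types (a b t : R) (g : R -> E).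

Lemma within_itv_epsilon_delta a b g : {within `[a, b], continuous g} ->
  forall t eps, a <= t <= b -> 0 < eps -> exists2 delta, 0 < delta &
    forall s, a <= s <= b -> `|s - t| < delta -> `|g s - g t| < eps.
Proof.
move=> cg t eps tab eps0.
have /cvgrPdist_lt/(_ _ eps0) := (cg t : g @ nbhs (t : subspace `[a, b]) --> g t).
rewrite /nbhs/= /nbhs_subspace/=; case: ifPn; last first.
  by move=> /negP; rewrite inE/= in_itv/= tab.
move=> _; rewrite /within/= => -[/= d d0 H]; exists d => // s sab st.
by rewrite distrC; apply: H; rewrite /= ?in_itv//= distrC.
Qed.

Lemma epsilon_delta_within_itv a b g :
  (forall t eps, a <= t <= b -> 0 < eps -> exists2 delta, 0 < delta &
    forall s, a <= s <= b -> `|s - t| < delta -> `|g s - g t| < eps) ->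
  {within `[a, b], continuous g}.
Proof.
move=> H; apply/subspace_continuousP => t /=; rewrite in_itv/= => tab.
apply/cvgrPdist_lt => eps eps0; have [d d0 {}H] := H t eps tab eps0.
rewrite /within/=; exists d => //= s /= st; rewrite in_itv/= => sab.
by rewrite distrC; apply: H => //; rewrite distrC.
Qed.

Lemma lipschitz_within_itv a b g :
  (forall s t, a <= s <= b -> a <= t <= b -> `|g s - g t| <= `|s - t|) ->
  {within `[a, b], continuous g}.
Proof.
move=> H; apply: epsilon_delta_within_itv => t eps tab e0; exists eps => // s sab.
by apply: le_lt_trans; exact: H.
Qed.

End Continuity.

(** * Distance to the boundary *)

Section BoundaryDistance.
Context {R : realType} {E : normedModType R}.
Implicit Types (x y z : E) (G : set E).

(** The first point of the segment from [x] to [y] that lies outside [G] is a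
    boundary point.  This is what ties [bdist], a distance to the boundary, to
    membership in [G]. *)
Lemma segment_meets_boundary G x y : open G -> G x -> ~ G y ->
  exists2 z, boundary G z & `|x - z| <= `|x - y|.
Proof.
move=> oG Gx Gy.
pose p (t : R) : E := x + t *: (y - x).
have pp s t : `|p s - p t| = `|s - t| * `|y - x|.
  by rewrite /p opprD addrACA subrr add0r -scalerBl normrZ.
have n0 : 0 < `|y - x|.
  by rewrite normr_gt0 subr_eq0; apply/eqP => yx; apply: Gy; rewrite yx.
pose S := [set t : R | 0 <= t <= 1 /\ ~ G (p t)].
have S1 : S 1 by split; [rewrite ler01 lexx|rewrite /p scale1r addrC subrK].
have lS : has_lbound S by exists 0 => t [/andP[]].
have hS : has_inf S by split => //; exists 1.
pose t := inf S.
have t1 : t <= 1 by apply: ge_inf.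
have t0 : 0 <= t by apply: lb_le_inf; [exists 1|move=> s [/andP[]]].
have GN : ~ G (p t).
  move=> Gt; have /nbhs_ballP[e /= e0 He] : nbhs (p t) G by apply: open_nbhs_nbhs.
  have e'0 : 0 < e / `|y - x| by rewrite divr_gt0.
  have [s Ss st] := inf_adherent e'0 hS.
  have ts : t <= s by apply: ge_inf.
  case: Ss => _; apply; apply: He; rewrite -ball_normE/= pp.
  by rewrite ler0_norm ?subr_le0// opprB -ltr_pdivlMr// ltrBlDl.
exists (p t); last first.
  rewrite -[x in `|x - p t|](addr0) -(scale0r (y - x)) -/(p 0) pp sub0r normrN distrC.
  by rewrite ler_piMl// ger0_norm.
split; last by move/interior_subset.
move=> B /nbhs_ballP[e /= e0 He].
have [t00|tp] := eqVneq t 0.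
  exists x; split => //; apply: He; rewrite -ball_normE/= t00 /p scale0r addr0.
  by rewrite subrr normr0.
have tpos : 0 < t by rewrite lt_neqAle eq_sym tp.
have e'0 : 0 < e / `|y - x| by rewrite divr_gt0.
(* Close to [t], but smaller than [t], hence inside [G]. *)
pose s := Num.max (t / 2) (t - e / `|y - x| / 2).
have st : s < t by rewrite /s gt_max; apply/andP; split; lra.
have s0 : 0 <= s by rewrite /s le_max; apply/orP; left; lra.
exists (p s); split.
  apply: contrapT => Gs; have : t <= s.
    by apply: ge_inf => //; split => //; apply/andP; split => //; lra.
  by rewrite leNgt st.
apply: He; rewrite -ball_normE/= pp ger0_norm; last lra.
have : t - e / `|y - x| / 2 <= s by rewrite /s le_max lexx orbT.
by rewrite -ltr_pdivlMr//; lra.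
Qed.

Lemma bdist_le G x z : boundary G z -> bdist G x <= `|x - z|.
Proof.
move=> Gz; apply: ge_inf; last by exists z.
by exists 0 => _ [w _ <-].
Qed.

Lemma bdist_ball G x y : open G -> G x -> `|x - y| < bdist G x -> G y.
Proof.
move=> oG Gx xy; apply: contrapT => Gy.
have [z Gz zxy] := segment_meets_boundary oG Gx Gy.
by have := le_lt_trans (le_trans (bdist_le x Gz) zxy) xy; rewrite ltxx.
Qed.

Lemma boundary_neq0 G : G !=set0 -> open G -> G `<` [set: E] ->
  boundary G !=set0.
Proof.
move=> [x Gx] oG [_ /existsNP[y /not_implyP[_ Gy]]].
by have [z Gz _] := segment_meets_boundary oG Gx Gy; exists z.
Qed.

Lemma bdist_gt0 G x : boundary G !=set0 -> open G -> G x -> 0 < bdist G x.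
Proof.
move=> [w Gw] oG Gx.
have /nbhs_ballP[e /= e0 He] : nbhs x G by apply: open_nbhs_nbhs.
apply: (lt_le_trans e0); apply: lb_le_inf; first by exists `|x - w|; exists w.
move=> _ [z [_ +] <-]; rewrite leNgt => Gz; apply/negP => zx; apply: Gz.
by rewrite (interior_id G).1//; apply: He; rewrite -ball_normE.
Qed.

Lemma bdist_lipschitz G x y : boundary G !=set0 ->
  bdist G y <= bdist G x + `|x - y|.
Proof.
move=> [w Gw]; rewrite -lerBlDr; apply: lb_le_inf.
  by exists `|x - w|; exists w.
move=> _ [z Gz <-]; rewrite lerBlDr (le_trans (bdist_le y Gz))//.
by rewrite (le_trans (ler_distD x _ _))// [leRHS]addrC (distrC y x).
Qed.

End BoundaryDistance.

(** * Length of curves *)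

Section PolygonalLength.
Context {R : realType} {E : normedModType R}.
Implicit Types (x y : E) (s t : seq E).

Fixpoint polygonal_length x s : R :=
  if s is y :: s' then `|x - y| + polygonal_length y s' else 0.

Lemma polygonal_length_ge0 x s : 0 <= polygonal_length x s.
Proof. by elim: s x => //= y s IH x; rewrite addr_ge0. Qed.

Lemma polygonal_length_cat x s t : polygonal_length x (s ++ t) =
  polygonal_length x s + polygonal_length (last x s) t.
Proof. by elim: s x => [|y s IH] x /=; rewrite ?add0r// IH addrA. Qed.

End PolygonalLength.

Section CurveLength.
Context {R : realType} {E : normedModType R}.
Implicit Types (a b c t : R) (g : R -> E).

Lemma partition_sumE a b g (s : seq R) :
  \sum_(0 <= n < size s) `|g (nth b (a :: s) n.+1) - g (nth b (a :: s) n)| =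
  polygonal_length (g a) (map g s).
Proof.
elim: s a => [|x s IH] a /=; first by rewrite big_nil.
by rewrite big_nat_recl//= -IH distrC.
Qed.

(** The recursive form of the partition sums makes inductions on partitions
    possible. *)
Lemma curve_lengthE a b g : curve_length a b g =
  ereal_sup [set (polygonal_length (g a) (map g s))%:E | s in [set s | itv_partition a b s]].
Proof.
rewrite /curve_length; congr ereal_sup; apply/seteqP; split => _ [s /= ps <-];
  by exists s => //; rewrite partition_sumE.
Qed.

Lemma curve_length_ub a b g s : itv_partition a b s ->
  ((polygonal_length (g a) (map g s))%:E <= curve_length a b g)%E.
Proof. by move=> ps; rewrite curve_lengthE; apply: ereal_sup_ubound; exists s. Qed.

Lemma curve_length_chord a b g : a <= b -> (`|g a - g b|%:E <= curve_length a b g)%E.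
Proof.
rewrite le_eqVlt => /predU1P[<-|ab].
  by have := @curve_length_ub a a g [::]; rewrite /= subrr normr0; apply; split.
have := @curve_length_ub a b g [:: b]; rewrite /= addr0; apply.
by split => //=; rewrite ab.
Qed.

Lemma curve_length_ge0 a b g : a <= b -> (0 <= curve_length a b g)%E.
Proof. by move=> ab; apply: le_trans (curve_length_chord g ab); rewrite lee_fin. Qed.

Lemma curve_lengthxx a g : curve_length a a g = 0%E.
Proof.
apply/eqP; rewrite eq_le curve_length_ge0// andbT curve_lengthE; apply: ge_ereal_sup.
by move=> _ [[|x s] ps <-]; rewrite ?lexx//; have := itv_partitionxx ps.
Qed.

Lemma partition_pasting a b c s1 s2 : itv_partition a c s1 -> itv_partition c b s2 ->
  itv_partition a b (s1 ++ s2).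
Proof.
move=> [p1 /eqP l1] [p2 /eqP l2]; split; first by rewrite cat_path p1 l1 p2.
by rewrite last_cat l1 l2.
Qed.

(** Finiteness of the members of [A] and [B] lets one move them across the
    inequality one at a time; the suprema themselves may be infinite. *)
Lemma ereal_sup_add_le (A B : set \bar R) (z : \bar R) :
  (forall x, A x -> (0 <= x < +oo)%E) -> (forall y, B y -> (0 <= y < +oo)%E) ->
  A !=set0 -> B !=set0 ->
  (forall x y, A x -> B y -> (x + y <= z)%E) -> (ereal_sup A + ereal_sup B <= z)%E.
Proof.
move=> A0 B0 [x0 Ax0] [y0 By0] H.
have fin (y : \bar R) : (0 <= y < +oo)%E -> y \is a fin_num.
  by move=> /andP[y1 y2]; rewrite ge0_fin_numE.
have H1 y : B y -> (ereal_sup A + y <= z)%E.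
  move=> By; rewrite -leeBrDr ?fin ?B0//; apply: ge_ereal_sup => x Ax.
  by rewrite leeBrDr ?fin ?B0// H.
have sA0 : (0 <= ereal_sup A)%E.
  by apply: (@le_trans _ _ x0); [case/andP: (A0 _ Ax0)|exact: ereal_sup_ubound].
have [Afin|] := boolP (ereal_sup A \is a fin_num).
  rewrite addeC -leeBrDr//; apply: ge_ereal_sup => y By.
  by rewrite leeBrDr// addeC H1.
rewrite ge0_fin_numE// -leNgt leye_eq => /eqP Aoo.
have /andP[y00 _] := B0 _ By0.
have := H1 _ By0; rewrite Aoo addye; last by rewrite -ltNye (lt_le_trans _ y00)// ltNyr.
by rewrite leye_eq => /eqP ->; rewrite leey.
Qed.

Lemma partitions_neq0 a b : a <= b -> [set s | itv_partition a b s] !=set0.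
Proof.
rewrite le_eqVlt => /predU1P[<-|ab]; first by exists [::]; split.
by exists [:: b]; split => //=; rewrite ab.
Qed.

Lemma curve_length_superadditive a b c g : a <= c -> c <= b ->
  (curve_length a c g + curve_length c b g <= curve_length a b g)%E.
Proof.
move=> ac cb; rewrite (curve_lengthE a c) (curve_lengthE c b).
apply: ereal_sup_add_le.
- by move=> _ [s _ <-]; rewrite lee_fin polygonal_length_ge0 ltry.
- by move=> _ [s _ <-]; rewrite lee_fin polygonal_length_ge0 ltry.
- by have [s ps] := partitions_neq0 ac; eexists; exists s.
- by have [s ps] := partitions_neq0 cb; eexists; exists s.
move=> _ _ [s1 p1 <-] [s2 p2 <-]; rewrite -EFinD.
have := curve_length_ub g (partition_pasting p1 p2).
rewrite map_cat polygonal_length_cat last_map.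
by case: p1 => _ /eqP ->.
Qed.

(** A partition of [[a, b]] need not contain [c].  In the induction the interval
    of the partition that straddles [c] is split there by the triangle
    inequality. *)
Lemma curve_lengthD a b c g : a <= c -> c <= b ->
  curve_length a b g = (curve_length a c g + curve_length c b g)%E.
Proof.
move=> ac cb; apply/eqP; rewrite eq_le; apply/andP; split; last first.
  exact: curve_length_superadditive.
rewrite (curve_lengthE a b); apply: ge_ereal_sup => _ [s ps <-].
elim: s a ac ps => [|x s IH] a ac ps /=.
  by apply: adde_ge0; exact: curve_length_ge0.
have ax : a < x by case: ps => /= /andP[].
have psx := itv_partition_cons ps.
have [xc|cx] := leP x c.
  rewrite EFinD; apply: (@le_trans _ _ (curve_length a x g +
     (curve_length x c g + curve_length c b g))%E).
    by apply: leeD; [apply/curve_length_chord/ltW|exact: IH].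
  by rewrite addeA leeD2r//; apply: curve_length_superadditive => //; exact: ltW.
apply: (@le_trans _ _ (`|g a - g c| + (`|g c - g x| + polygonal_length (g x) (map g s)))%:E).
  by rewrite lee_fin addrA lerD2r ler_distD.
rewrite EFinD; apply: leeD; first exact: curve_length_chord.
apply: (@curve_length_ub c b g (x :: s)).
by case: psx => p /eqP l; split => //=; rewrite ?cx ?p ?l.
Qed.

Lemma curve_length_le a b c t g : a <= c -> c <= t -> t <= b ->
  (curve_length c t g <= curve_length a b g)%E.
Proof.
move=> ac ct tb.
rewrite (curve_lengthD g ac (le_trans ct tb)) (curve_lengthD g ct tb).
rewrite addeCA leeDl//; apply: adde_ge0; exact: curve_length_ge0.
Qed.

Lemma lipschitz_curve_length a b g :
  (forall s t, a <= s <= b -> a <= t <= b -> `|g s - g t| <= `|s - t|) ->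
  a <= b -> (curve_length a b g <= (b - a)%:E)%E.
Proof.
move=> H ab; rewrite curve_lengthE; apply: ge_ereal_sup => _ [s ps <-]; rewrite lee_fin.
elim: s a H ab ps => [|x s IH] a H ab ps /=.
  by rewrite subr_ge0.
have ax : a < x by case: ps => /= /andP[].
have psx := itv_partition_cons ps.
have xb : x <= b := itv_partition_le psx.
have := IH x; move=> /(_ _ xb psx) IHx.
have : `|g a - g x| <= x - a.
  rewrite -[x - a]gtr0_norm ?subr_gt0// distrC (le_trans (H _ _ _ _))// ?lexx ?ab//.
  by rewrite (ltW ax).
move=> h; apply: (le_trans (lerD h (IHx _))); last lra.
by move=> u v /andP[u1 u2] /andP[v1 v2]; apply: H; apply/andP; split => //; lra.
Qed.

End CurveLength.

(** * Arc length parametrization *)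

Section ArcLength.
Context {R : realType} {E : normedModType R}.
Implicit Types (a b t u : R) (g : R -> E).

Lemma rectifiable_curve_length a b s t g : rectifiable a b g ->
  a <= s -> s <= t -> t <= b ->
  curve_length s t g =
    (fine (curve_length a t g) - fine (curve_length a s g))%:E.
Proof.
move=> rg as_ st tb.
have fin p q : a <= p -> p <= q -> q <= b -> curve_length p q g \is a fin_num.
  move=> ap pq qb; rewrite ge0_fin_numE ?curve_length_ge0//.
  by apply: le_lt_trans rg; exact: curve_length_le.
rewrite (curve_lengthD g as_ st) fineD ?fin ?(le_trans st)// (addrC (fine _)) addrK.
by rewrite fineK ?fin.
Qed.

Lemma rectifiable_chord a b s t g : rectifiable a b g ->
  a <= s -> s <= t -> t <= b ->
  `|g s - g t| <= fine (curve_length a t g) - fine (curve_length a s g).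
Proof.
move=> rg as_ st tb; rewrite -lee_fin -(rectifiable_curve_length rg)//.
exact: curve_length_chord.
Qed.

(** Lower semicontinuity of length from the left: moving the last node of a
    partition of [[a, t0]] slightly to the left changes its sum by little. *)
Lemma curve_length_le_left_limit a b t0 u g :
  {within `[a, b], continuous g} -> a <= t0 <= b -> 0 <= u ->
  (forall p, p < t0 -> exists2 t, a <= t <= t0 & p < t /\ (curve_length a t g <= u%:E)%E) ->
  (curve_length a t0 g <= u%:E)%E.
Proof.
move=> cg /andP[at0 t0b] u0 H; apply/lee_addgt0Pr => eps eps0.
rewrite curve_lengthE; apply: ge_ereal_sup => _ [s ps <-].
case/lastP: s ps => [|s x] ps; first by rewrite lee_fin /=; lra.
have xt0 : x = t0 by case: ps => _; rewrite last_rcons => /eqP.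
subst x.
have t0i : a <= t0 <= b by rewrite at0.
have [d d0 Hd] := within_itv_epsilon_delta cg t0i eps0.
have pt0 : last a s < t0 by case: ps; rewrite rcons_path => /andP[].
have [t /andP[at1 tt0] [+ tu]] := H (Num.max (last a s) (t0 - d)) ltac:(rewrite gt_max pt0; lra).
rewrite gt_max => /andP[st dt].
have gt : `|g t - g t0| < eps.
  apply: Hd; first by rewrite at1 (le_trans tt0).
  by rewrite ler0_norm ?subr_le0//; lra.
have pst : itv_partition a t (rcons s t).
  by case: ps; rewrite rcons_path => /andP[p _] _; split; rewrite ?rcons_path ?p ?last_rcons.
have := le_trans (curve_length_ub g pst) tu.
rewrite -EFinD !lee_fin !map_rcons -!cats1 !polygonal_length_cat /= !addr0 last_map.
move=> h; have := ler_distD (g t) (g (last a s)) (g t0); lra.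
Qed.

(** Length is a continuous function of the endpoint, so it takes every
    intermediate value.  The time sought is the supremum [t0] of the times at
    which the length is at most [u].  Left semicontinuity gives length at most [u]
    at [t0].  If it were smaller, a nearly optimal partition of [[t0, b]] would
    show that little length is spent just after [t0], and [t0] could be
    increased. *)
Lemma arclength_surjective a b g u : is_curve a b g -> rectifiable a b g ->
  0 <= u <= fine (curve_length a b g) ->
  exists2 t, a <= t <= b & curve_length a t g = u%:E.
Proof.
move=> [ab cg] rg /andP[u0 uL].
pose ell t := fine (curve_length a t g).
have ellE t : a <= t <= b -> curve_length a t g = (ell t)%:E.
  move=> /andP[a_t tb]; rewrite (rectifiable_curve_length rg)//.
  by rewrite curve_lengthxx subr0.
pose S := [set t | a <= t <= b /\ ell t <= u].
have Sa : S a by split; rewrite ?lexx// /ell curve_lengthxx.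
have Sb : has_sup S by split; [exists a|exists b => t [/andP[]]].
pose t0 := sup S.
have at0 : a <= t0 by apply: sup_upper_bound.
have t0b : t0 <= b by apply: sup_le_ub; [exists a|move=> t [/andP[]]].
have t0i : a <= t0 <= b by rewrite at0.
exists t0 => //; apply/eqP; rewrite eq_le; apply/andP; split.
  apply: (@curve_length_le_left_limit _ b) => // p pt0.
  have [t St pt] : exists2 t, S t & p < t.
    have e0 : 0 < t0 - p by rewrite subr_gt0.
    by have [t St] := sup_adherent e0 Sb; rewrite subKr; exists t.
  exists t; last by split => //; rewrite ellE ?lee_fin; case: St.
  by case: (St) => /andP[-> _] _; apply: sup_upper_bound.
rewrite leNgt; apply/negP; rewrite ellE// lte_fin => lt_u.
have t0b' : t0 < b.
  by rewrite lt_neqAle t0b andbT; apply/eqP => t0E; move: lt_u; rewrite t0E ltNge uL.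
pose eps := (u - ell t0) / 3.
have eps0 : 0 < eps by rewrite /eps; lra.
have [Q pQ lQ] : exists2 Q, itv_partition t0 b Q &
    ell b - ell t0 - eps < polygonal_length (g t0) (map g Q).
  have : ((ell b - ell t0 - eps)%:E < curve_length t0 b g)%E.
    by rewrite (rectifiable_curve_length rg)// lte_fin -/(ell b) -/(ell t0); lra.
  rewrite curve_lengthE => /ereal_sup_gt[_ [Q pQ <-]]; rewrite lte_fin => h.
  by exists Q.
have [d d0 Hd] := within_itv_epsilon_delta cg t0i eps0.
case: Q pQ lQ => [|x Q] pQ lQ.
  by have := itv_partition_nil pQ => t0E; move: t0b'; rewrite t0E ltxx.
have t0x : t0 < x by case: pQ => /= /andP[].
have xb : x <= b := itv_partition_le (itv_partition_cons pQ).
(* A time shortly after [t0] and before the first node [x] of [Q]. *)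
pose t := Num.min (t0 + d / 2) ((t0 + x) / 2).
have t0t : t0 < t by rewrite /t lt_min; apply/andP; split; lra.
have td : t <= t0 + d / 2 by rewrite /t ge_min lexx.
have tx : t <= (t0 + x) / 2 by rewrite /t ge_min lexx orbT.
have gt : `|g t - g t0| < eps.
  by apply: Hd; [apply/andP; split; lra|rewrite gtr0_norm ?subr_gt0//; lra].
have pt : itv_partition t b (x :: Q).
  case: pQ => /= /andP[_ p] l; split => //=; rewrite p andbT; lra.
have := curve_length_ub g pt.
rewrite (rectifiable_curve_length rg); [|lra|lra|by []].
rewrite -/(ell b) -/(ell t) lee_fin /= => h.
move: lQ => /= lQ; rewrite distrC in gt.
have tri := ler_distD (g t) (g t0) (g x).
have : t <= t0.
  apply: sup_upper_bound => //; split; first by apply/andP; split; lra.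
  have epsE : eps * 3 = u - ell t0 by rewrite /eps; lra.
  clearbody eps; lra.
by rewrite leNgt t0t.
Qed.

Lemma arclength_paramP a b g u : is_curve a b g -> rectifiable a b g ->
  0 <= u <= fine (curve_length a b g) ->
  exists2 t, a <= t <= b & curve_length a t g = u%:E /\ arclength_param a b g u = g t.
Proof.
move=> cg rg hu; have [t tab tu] := arclength_surjective cg rg hu.
rewrite /arclength_param; case: xgetP => [s _ [+ su]|/(_ t) []].
  by rewrite in_itv/= => sab; exists s.
by split; rewrite ?in_itv.
Qed.

Lemma arclength_param_in a b g u : a <= b ->
  exists2 t, a <= t <= b & arclength_param a b g u = g t.
Proof.
move=> ab; rewrite /arclength_param; case: xgetP => [s _ [+ _]|_].
  by rewrite in_itv/= => sab; exists s.
by exists a; rewrite ?lexx.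
Qed.

Lemma arclength_param_lipschitz a b g u v : is_curve a b g -> rectifiable a b g ->
  0 <= u <= fine (curve_length a b g) -> 0 <= v <= fine (curve_length a b g) ->
  `|arclength_param a b g u - arclength_param a b g v| <= `|u - v|.
Proof.
move=> cg rg hu hv.
have [s /andP[sa sb] [su ->]] := arclength_paramP cg rg hu.
have [t /andP[ta tb] [tv ->]] := arclength_paramP cg rg hv.
have [st|ts] := leP s t.
  have := rectifiable_chord rg sa st tb; rewrite su tv /= => /le_trans; apply.
  by rewrite distrC ler_norm.
have := rectifiable_chord rg ta (ltW ts) sb; rewrite su tv /= distrC => /le_trans; apply.
exact: ler_norm.
Qed.

Lemma arclength_param0 a b g : is_curve a b g -> rectifiable a b g ->
  arclength_param a b g 0 = g a.
Proof.
move=> cg rg; have ab : a <= b by case: cg.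
have L0 : 0 <= fine (curve_length a b g) by rewrite fine_ge0// curve_length_ge0.
have h0 : 0 <= (0 : R) <= fine (curve_length a b g) by rewrite lexx.
have [t /andP[ta tb] [t0 ->]] := arclength_paramP cg rg h0.
have := rectifiable_chord rg (lexx a) ta tb; rewrite t0 curve_lengthxx subrr normr_le0 subr_eq0.
by move/eqP.
Qed.

Lemma arclength_paramL a b g : is_curve a b g -> rectifiable a b g ->
  arclength_param a b g (fine (curve_length a b g)) = g b.
Proof.
move=> cg rg; have ab : a <= b by case: cg.
have L0 : 0 <= fine (curve_length a b g) by rewrite fine_ge0// curve_length_ge0.
have h0 : 0 <= fine (curve_length a b g) <= fine (curve_length a b g) by rewrite lexx L0.
have [t /andP[ta tb] [t0 ->]] := arclength_paramP cg rg h0.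
have := rectifiable_chord rg ta tb (lexx b); rewrite t0 /= subrr normr_le0 subr_eq0.
by move/eqP.
Qed.

End ArcLength.

(** * Quasihyperbolic length and chains *)

Section QuasihyperbolicIntegral.
Context {R : realType} {E : normedModType R}.
Implicit Types (a b t u : R) (g : R -> E) (x y z : E) (G : set E).

(** Along a Lipschitz curve in [G] the integrand is continuous, because [bdist] is
    Lipschitz and positive on [G]. *)
Lemma measurable_inv_bdist G (f : R -> E) p q : boundary G !=set0 -> open G ->
  (forall u, p <= u <= q -> G (f u)) ->
  (forall u v, p <= u <= q -> p <= v <= q -> `|f u - f v| <= `|u - v|) ->
  measurable_fun `[p, q] (EFin \o (fun u => (bdist G (f u))^-1)).
Proof.
move=> bG oG fG fL; apply/measurable_EFinP.
apply: subspace_continuous_measurable_fun; first exact: measurable_itv.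
have ch : {within `[p, q], continuous (fun u => bdist G (f u) : R)}.
  apply: (@lipschitz_within_itv _ R^o) => u v up vp.
  apply: le_trans (fL u v up vp).
  have h1 := bdist_lipschitz (f u) (f v) bG; have h2 := bdist_lipschitz (f v) (f u) bG.
  rewrite distrC in h2; rewrite ler_norml; apply/andP; split; lra.
apply/subspace_continuousP => u up; apply: cvgV.
  by rewrite gt_eqF// bdist_gt0//; apply: fG; move: up; rewrite /= in_itv.
exact: (@subspace_continuousP _ _ _ _).1 ch u up.
Qed.

Lemma line_integral_inv_bdist_le G a b g (K : R) : boundary G !=set0 -> open G ->
  is_curve a b g -> rectifiable a b g -> g @` `[a, b] `<=` G ->
  (forall t, a <= t <= b -> (bdist G (g t))^-1 <= K) ->
  (line_integral a b g (fun z => ((bdist G z)^-1)%R)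
     <= (K * fine (curve_length a b g))%:E)%E.
Proof.
move=> bG oG cg rg gG gK; have ab : a <= b by case: cg.
set L := fine _.
have L0 : 0 <= L by rewrite fine_ge0// curve_length_ge0.
have pG u : G (arclength_param a b g u).
  by have [t tab ->] := arclength_param_in g u ab; apply: gG; exists t; rewrite //= in_itv.
have -> : ((K * L)%:E = \int[lebesgue_measure]_(u in `[0%R, L]) cst (K%:E : \bar R) u)%E.
  rewrite integral_cst; last exact: measurable_itv.
  rewrite /= lebesgue_measure_itv/= lte_fin; case: ltgtP L0 => // [L0 _|<- _].
    by rewrite -EFinB -EFinM subr0.
  by rewrite mule0 mulr0.
rewrite /line_integral -/L; apply: ge0_le_integral.
- exact: measurable_itv.
- by move=> u _; rewrite lee_fin invr_ge0 ltW// bdist_gt0.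
- apply: measurable_inv_bdist => // u v up vp.
  exact: arclength_param_lipschitz.
- exact: measurable_cst.
- move=> u _; rewrite lee_fin.
  by have [t tab ->] := arclength_param_in g u ab; exact: gK.
Qed.

(** Adjacency is a bounded quasihyperbolic step: the segment [[x, y]] lies in a
    ball whose radius is half the distance from its center to the boundary.  The
    maximum makes the relation symmetric, so that chains can be reversed. *)
Definition adjacent G x y : bool :=
  `[< [/\ G x, G y & `|x - y| <= Num.max (bdist G x) (bdist G y) / 2] >].

(** A step that advances by half of [d = bdist G (f u)] costs at least [1 / 3] of
    the integral: the step has parameter length [d / 2] and on it the distance to
    the boundary is at most [3 d / 2].  Hence an integral below [N / 3] leaves room
    for at most [N] steps. *)
Lemma chain_of_integral G (f : R -> E) (L : R) N : boundary G !=set0 -> open G ->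
  (forall u, 0 <= u <= L -> G (f u)) ->
  (forall u v, 0 <= u <= L -> 0 <= v <= L -> `|f u - f v| <= `|u - v|) ->
  forall u, 0 <= u <= L ->
  (\int[lebesgue_measure]_(v in `[u, L]) ((bdist G (f v))^-1)%:E < (N%:R / 3)%:E)%E ->
  exists s, [/\ (size s <= N)%N, path (adjacent G) (f u) s & last (f u) s = f L].
Proof.
move=> bG oG fG fL; elim: N => [|N IH] u /andP[u0 uL].
  rewrite mul0r ltNge integral_ge0// => v; rewrite /= in_itv/= => /andP[uv vL].
  by rewrite lee_fin invr_ge0 ltW// bdist_gt0//; apply: fG; rewrite (le_trans u0).
set d := bdist G (f u).
have d0 : 0 < d by apply: bdist_gt0 => //; apply: fG; rewrite u0.
have L0 : 0 <= L := le_trans u0 uL.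
have [Ld _|dL] := leP L (u + d / 2).
  exists [:: f L]; split => //=; rewrite andbT; apply/asboolP.
  split; [by apply: fG; rewrite u0|by apply: fG; rewrite L0 lexx|].
  apply: (le_trans (fL _ _ _ _)); rewrite ?u0 ?L0 ?lexx//.
  apply: (@le_trans _ _ (d / 2)); first by rewrite ler0_norm ?subr_le0//; lra.
  by rewrite ler_pM2r// le_max lexx.
set u' := u + d / 2 in dL *.
have uu' : u < u' by rewrite /u'; lra.
have u'i : 0 <= u' <= L by rewrite (ltW dL) (le_trans u0 (ltW uu')).
have -> : `[u, L]%classic = `[u, u'[%classic `|` `[u', L]%classic.
  apply/seteqP; split => v /=; rewrite !in_itv/=.
    by move=> /andP[-> ->]; case: (ltP v u') => _; [left|right].
  case=> /andP[h1 h2]; apply/andP; split => //; lra.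
have m : measurable_fun (`[u, u'[%classic `|` `[u', L]%classic)
    (EFin \o (fun v => (bdist G (f v))^-1)).
  apply: (@measurable_funS _ _ _ _ `[0%R, L]); first exact: measurable_itv.
    by move=> v /= [] ; rewrite !in_itv/= => /andP[h1 h2]; apply/andP; split; lra.
  exact: measurable_inv_bdist.
have pos v : (`[u, u'[%classic `|` `[u', L]%classic) v -> (0 <= ((bdist G (f v))^-1)%:E)%E.
  move=> h; rewrite lee_fin invr_ge0 ltW// bdist_gt0//; apply: fG.
  by case: h => /=; rewrite in_itv/= => /andP[h1 h2]; apply/andP; split; lra.
rewrite ge0_integral_setU//=; [|exact: measurable_itv..|]; last first.
  apply/disj_setPRL => v /=; rewrite !in_itv/= => /andP[h1 h2] /andP[h3 h4]; lra.
have third : ((1 / 3)%:E <= \int[lebesgue_measure]_(v in `[u, u'[) ((bdist G (f v))^-1)%:E)%E.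
  have -> : ((1 / 3)%:E = \int[lebesgue_measure]_(v in `[u, u'[)
     cst (((3 / 2 * d)^-1)%:E : \bar R) v)%E.
    rewrite integral_cst; last exact: measurable_itv.
    rewrite /= lebesgue_measure_itv/= lte_fin uu' -EFinB -EFinM; congr EFin.
    by rewrite /u'; field; rewrite gt_eqF.
  apply: ge0_le_integral.
  - exact: measurable_itv.
  - by move=> v _; rewrite lee_fin invr_ge0; lra.
  - exact: measurable_cst.
  - by apply: measurable_funS m; [exact: measurableU|exact: subsetUl].
  - move=> v vi; rewrite lee_fin.
    move: (vi); rewrite /= in_itv/= => /andP[h1 h2].
    have v0 : 0 <= v <= L by apply/andP; split; lra.
    rewrite lef_pV2 ?posrE ?bdist_gt0//; [|lra|exact: fG].
    have h3 := bdist_lipschitz (f u) (f v) bG.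
    have := fL u v ltac:(by rewrite u0) v0; rewrite ler0_norm; last lra.
    rewrite -/d in h3; move: h2; rewrite /u'; lra.
move=> hlt.
have /(IH u' u'i)[s [sN ps ls]] :
    (\int[lebesgue_measure]_(v in `[u', L]) ((bdist G (f v))^-1)%:E < (N%:R / 3)%:E)%E.
  rewrite -(@lteD2lE _ (1 / 3)%:E)//; apply: le_lt_trans (leeD2r _ third) _.
  by apply: (lt_le_trans hlt); rewrite -EFinD lee_fin -natr1; lra.
exists (f u' :: s); split => //=; rewrite ps andbT; apply/asboolP.
split; [by apply: fG; rewrite u0|exact: fG|].
apply: (le_trans (fL _ _ _ _)) => //; first by rewrite u0.
apply: (@le_trans _ _ (d / 2)); first by rewrite ler0_norm ?subr_le0 ?(ltW uu')//; rewrite /u'; lra.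
by rewrite ler_pM2r// le_max lexx.
Qed.

Lemma chain_of_qhyp_lt G x y N : boundary G !=set0 -> open G ->
  (qhyp G x y < (N%:R / 3)%:E)%E ->
  exists s, [/\ (size s <= N)%N, path (adjacent G) x s & last x s = y].
Proof.
move=> bG oG /ereal_inf_lt[_ [a [b [g [cg rg [ga gb gG] ->]]]]] lt.
have ab : a <= b by case: cg.
have L0 : 0 <= fine (curve_length a b g) by rewrite fine_ge0// curve_length_ge0.
rewrite -ga -gb -(arclength_param0 cg rg) -(arclength_paramL cg rg).
apply: (chain_of_integral bG oG _ _ _ lt); last by rewrite lexx.
- move=> u _; have [t tab ->] := arclength_param_in g u ab.
  by apply: gG; exists t; rewrite //= in_itv.
- by move=> u v; exact: arclength_param_lipschitz.
Qed.

End QuasihyperbolicIntegral.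

(** * Arcs from polygonal chains *)

Section LoopErasure.
Context {R : realType} {E : normedModType R}.
Implicit Types (x y z p q : E) (G : set E) (s : seq E) (L : R) (f : R -> E).

(** Injective 1-Lipschitz curves on [[0, L]].  The length between two parameters is
    then at most their difference, so the parameter itself can serve as the length
    in the estimates. *)
Definition lipschitz_arc L f : Prop :=
  (forall u v, 0 <= u <= L -> 0 <= v <= L -> `|f u - f v| <= `|u - v|) /\
  (forall u v, 0 <= u <= L -> 0 <= v <= L -> f u = f v -> u = v).

Definition segment_point p q (l : R) : E := p + l *: (q - p).

Lemma segment_pointB p q l m :
  `|segment_point p q l - segment_point p q m| = `|l - m| * `|p - q|.
Proof.
by rewrite /segment_point opprD addrACA subrr add0r -scalerBl normrZ (distrC p).
Qed.

Lemma segment_point0 p q : segment_point p q 0 = p.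
Proof. by rewrite /segment_point scale0r addr0. Qed.

Lemma segment_point1 p q : segment_point p q 1 = q.
Proof. by rewrite /segment_point scale1r addrC subrK. Qed.

Lemma adjacent_sym G x y : adjacent G x y = adjacent G y x.
Proof.
apply/asboolP/asboolP => -[Gx Gy]; rewrite distrC maxC => h; by split.
Qed.

Lemma adjacent_bdist G x y : boundary G !=set0 -> adjacent G x y ->
  bdist G x <= 2 * bdist G y.
Proof.
move=> bG /asboolP[Gx Gy]; have h1 := bdist_lipschitz x y bG.
have h2 := bdist_lipschitz y x bG; rewrite distrC in h2.
case: (leP (bdist G x) (bdist G y)) => h h3; lra.
Qed.

Lemma adjacent_segment G p q l : boundary G !=set0 -> open G -> adjacent G p q ->
  0 <= l <= 1 ->
  G (segment_point p q l) /\ bdist G p <= 2 * bdist G (segment_point p q l).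
Proof.
move=> bG oG /asboolP[Gp Gq pq] /andP[l0 l1]; set z := segment_point p q l.
have pz : `|p - z| = l * `|p - q|.
  by rewrite -[X in `|X - _|](segment_point0 p q) segment_pointB sub0r normrN ger0_norm.
have qz : `|q - z| = (1 - l) * `|p - q|.
  by rewrite -[X in `|X - _|](segment_point1 p q) segment_pointB ger0_norm// subr_ge0.
have n0 := normr_ge0 (p - q).
have pz' : `|p - z| <= `|p - q| by rewrite pz; nra.
have qz' : `|q - z| <= `|p - q| by rewrite qz; nra.
have p0 := bdist_gt0 bG oG Gp; have q0 := bdist_gt0 bG oG Gq.
have h1 := bdist_lipschitz z p bG; have h2 := bdist_lipschitz z q bG.
rewrite distrC in h1; rewrite distrC in h2.
case: (leP (bdist G p) (bdist G q)) pq => h pq.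
  by split; [apply: (bdist_ball oG Gq); lra|lra].
by split; [apply: (bdist_ball oG Gp); lra|lra].
Qed.

(** Loop erasure for one added segment: the arc is cut at the last point of the
    segment [[f L, q]] that lies on it and continues along the rest of the
    segment.  Compactness of the arc gives this last point.  The cut shortens
    what precedes and what follows, so arc-length bounds survive. *)
Lemma extend_lipschitz_arc L f q : 0 <= L -> lipschitz_arc L f ->
  exists L' f' v, [/\ lipschitz_arc L' f', f' 0 = f 0, f' L' = q,
    [/\ 0 <= v <= L, v <= L' & L' - v <= `|f L - q|] &
    forall t, 0 <= t <= L' -> (t <= v /\ f' t = f t) \/
      (v <= t /\ exists2 l, 0 <= l <= 1 & f' t = segment_point (f L) q l)].
Proof.
move=> L0 [fL fI]; set D := `|f L - q|.
have [D0|Dn0] := eqVneq D 0.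
  exists L, f, L; split => //.
  - by move/eqP: D0; rewrite normr_eq0 subr_eq0 => /eqP.
  - by rewrite L0 lexx subrr normr_ge0.
  - by move=> t /andP[_ tL]; left.
have D_gt0 : 0 < D by rewrite lt_neqAle eq_sym Dn0 normr_ge0.
pose sg (u : R) := segment_point (f L) q (u / D).
have sgB u v : `|sg u - sg v| = `|u - v|.
  by rewrite segment_pointB -mulrBl normrM [`|D^-1|]ger0_norm ?invr_ge0 ?ltW// mulfVK.
pose U := [set u | 0 <= u <= D /\ exists2 v : R, 0 <= v <= L & sg u = f v].
have U0 : U 0.
  split; first by rewrite lexx ltW.
  by exists L; rewrite ?L0 ?lexx// /sg mul0r segment_point0.
have hU : has_sup U by split; [exists 0|exists D => u [/andP[]]].
pose u0 := sup U.
have u00 : 0 <= u0 by apply: sup_upper_bound.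
have u0D : u0 <= D by apply: sup_le_ub; [exists 0|move=> u [/andP[]]].
have [v0 /andP[v00 v0L] sv0] : exists2 v : R, 0 <= v <= L & sg u0 = f v.
  have cK : closed (f @` `[0, L]).
    apply: compact_closed; first exact: norm_hausdorff.
    apply: continuous_compact; last exact: segment_compact.
    exact: lipschitz_within_itv.
  have : (f @` `[0, L]) (sg u0).
    apply: cK => B /nbhs_ballP[e /= e0 He].
    have [u Uu eu] := sup_adherent e0 hU.
    have uu0 : u <= u0 by apply: sup_upper_bound.
    case: Uu => _ [v vi uv]; exists (sg u); split.
      by rewrite uv; exists v; rewrite //= in_itv.
    apply: He; rewrite -ball_normE/= sgB ger0_norm ?subr_ge0//.
    by rewrite ltrBlDr addrC -ltrBlDr.
  by case=> v /=; rewrite in_itv/= => vi <-; exists v.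
have maxU (u v : R) : u0 < u <= D -> 0 <= v <= L -> sg u <> f v.
  move=> /andP[uu0 uD] vi uv; have : u <= u0.
    by apply: sup_upper_bound => //; split; [rewrite uD andbT; lra|exists v].
  by rewrite leNgt uu0.
pose f' (t : R) := if t <= v0 then f t else sg (u0 + t - v0).
have f'1 (t : R) : t <= v0 -> f' t = f t by rewrite /f' => ->.
have f'2 (t : R) : v0 <= t -> f' t = sg (u0 + t - v0).
  rewrite le_eqVlt => /predU1P[<-|vt]; first by rewrite f'1// addrK.
  by rewrite /f' leNgt vt.
have lip (s t : R) : 0 <= s -> s <= t -> t <= v0 + D - u0 -> `|f' s - f' t| <= t - s.
  move=> s0 st tL; have [tv|vt] := leP t v0.
    rewrite !f'1//; last lra.
    rewrite (le_trans (fL _ _ _ _))//; [apply/andP; split; lra..|].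
    by rewrite ler0_norm; lra.
  rewrite (f'2 t); last lra.
  have [sv|vs] := leP s v0.
    rewrite f'1//; apply: (le_trans (ler_distD (f v0) _ _)).
    have h1 : `|f s - f v0| <= v0 - s.
      rewrite (le_trans (fL _ _ _ _))//; [apply/andP; split; lra..|].
      by rewrite ler0_norm; lra.
    have h2 : `|f v0 - sg (u0 + t - v0)| = t - v0.
      by rewrite -sv0 sgB ler0_norm; lra.
    lra.
  by rewrite f'2; [rewrite sgB ler0_norm; lra|lra].
exists (v0 + D - u0), f', v0; split.
- split=> s t /andP[s0 sL] /andP[t0 tL].
    have [st|ts] := leP s t.
      by rewrite ler0_norm ?opprB ?subr_le0//; exact: lip.
    by rewrite gtr0_norm ?subr_gt0// distrC; apply: lip; lra.
  wlog st : s t s0 sL t0 tL / s <= t.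
    move=> H; have [st|ts] := leP s t; first exact: H.
    by move=> /esym/(H t s t0 tL s0 sL (ltW ts)).
  have [tv|vt] := leP t v0.
    by rewrite !f'1//; [move=> /fI; apply; apply/andP; split; lra|lra].
  rewrite (f'2 t); last lra.
  have [sv|vs] := leP s v0.
    rewrite f'1// => /esym/maxU; case; apply/andP; split; lra.
  rewrite f'2; last lra.
  move=> /eqP; rewrite -subr_eq0 -normr_eq0 sgB normr_eq0 subr_eq0 => /eqP h; lra.
- by rewrite f'1.
- rewrite f'2; last lra.
  rewrite (_ : u0 + (v0 + D - u0) - v0 = D); last lra.
  by rewrite /sg divff// segment_point1.
- by split; [rewrite v00|lra|rewrite -/D; lra].
move=> t /andP[t0 tL]; have [tv|vt] := leP t v0; first by left; rewrite f'1.
right; split; [exact: ltW|exists ((u0 + t - v0) / D); last by rewrite f'2// ltW].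
apply/andP; split; first by rewrite divr_ge0//; lra.
by rewrite ler_pdivrMr// mul1r; lra.
Qed.

(** The discrete form of the cigar condition; [acc] is the length of the part of the
    chain before [x].  The step after a vertex is counted in both alternatives, so
    that the bound also serves for the points inside this step. *)
Fixpoint cigar_chain G (C acc : R) x s : Prop :=
  if s is y :: s' then
    (acc + `|x - y| <= C * bdist G x \/ polygonal_length x s <= C * bdist G x)
    /\ cigar_chain G C (acc + `|x - y|) y s'
  else True.

(** The segments of the chain are attached one after the other with loop erasure.
    The invariant bounds, at each point of the arc built so far, either the length
    before it or the length after it including the rest of the chain.  Points
    inside a segment may be half as far from the boundary as its first vertex,
    whence the factor 2. *)
Lemma arc_of_cigar_chain G (C acc : R) s L f : boundary G !=set0 -> open G ->
  0 <= C -> 0 <= L <= acc -> lipschitz_arc L f ->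
  (forall t, 0 <= t <= L -> G (f t)) ->
  path (adjacent G) (f L) s -> cigar_chain G C acc (f L) s ->
  (forall t, 0 <= t <= L -> t <= 2 * C * bdist G (f t) \/
     L - t + polygonal_length (f L) s <= 2 * C * bdist G (f t)) ->
  exists L' f', [/\ 0 <= L' <= acc + polygonal_length (f L) s, lipschitz_arc L' f',
    f' 0 = f 0 /\ f' L' = last (f L) s, forall t, 0 <= t <= L' -> G (f' t) &
    forall t, 0 <= t <= L' -> t <= 2 * C * bdist G (f' t) \/
      L' - t <= 2 * C * bdist G (f' t)].
Proof.
move=> bG oG C0; elim: s acc L f => [|q s IH] acc L f /andP[L0 Lacc] fL fG.
  move=> _ _ H; exists L, f; split => //; first by rewrite L0 /= addr0.
  by move=> t /H; rewrite /= addr0.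
rewrite [path _ _ _]/= => /andP[adj ps] [Hq Hs] H.
have [L1 [f1 [v [lf1 f10 f1L [/andP[v0 vL] vL1 L1v] f1t]]]] := extend_lipschitz_arc q L0 fL.
have s0 := polygonal_length_ge0 q s.
rewrite /= in H Hq *.
have n0 := normr_ge0 (f L - q).
have := IH (acc + `|f L - q|) L1 f1; rewrite f1L f10 => IH1.
have [||t /andP[t0 tL1]|||t /andP[t0 tL1]|L' [f' [L'i lf' f'e f'G f't]]] := IH1.
- by apply/andP; split; lra.
- by [].
- case: (f1t t _) => [|[tv ->]|[vt [l li ->]]]; first by rewrite t0.
    by apply: fG; apply/andP; split; lra.
  by have [] := adjacent_segment bG oG adj li.
- by [].
- by [].
- case: (f1t t _) => [|[tv ->]|[vt [l li ->]]]; first by rewrite t0.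
    have [|h|h] := H t; first by apply/andP; split; lra.
      by left.
    by right; lra.
  have [_ h] := adjacent_segment bG oG adj li.
  have h' : C * bdist G (f L) <= 2 * C * bdist G (segment_point (f L) q l).
    by rewrite -mulrA mulrCA ler_wpM2l.
  by case: Hq => Hq; [left|right]; lra.
- by exists L', f'; rewrite addrA.
Qed.

Lemma uniform_arc_of_cigar_chain G (C K : R) x s : boundary G !=set0 -> open G ->
  0 <= C -> G x -> path (adjacent G) x s -> cigar_chain G C 0 x s ->
  2 * C <= K ->
  exists (a b : R) (g : R -> E),
    [/\ is_arc a b g, joins_in G a b g x (last x s),
        (curve_length a b g <= (polygonal_length x s)%:E)%E &
        forall t, t \in `[a, b] ->
          (mine (curve_length a t g) (curve_length t b g)
             <= (K * bdist G (g t))%:E)%E].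
Proof.
move=> bG oG C0 Gx ps cs CK.
have [||||||L [f [/andP[L0 LS] [fL fI] [f0 fe] fG fK]]] :=
  @arc_of_cigar_chain G C 0 s 0 (fun=> x) bG oG C0 => //.
- by rewrite lexx.
- split=> [u v|u v /andP[u0 u1] /andP[v0 v1] _]; first by rewrite subrr normr0.
  lra.
- move=> t /andP[t0 t1]; left; have -> : t = 0 by lra.
  by rewrite !mulr_ge0// ltW// bdist_gt0.
rewrite add0r in LS.
have len u v : 0 <= u -> u <= v -> v <= L -> (curve_length u v f <= (v - u)%:E)%E.
  move=> u0 uv vL; apply: lipschitz_curve_length => // s1 t1 /andP[h1 h2] /andP[h3 h4].
  by apply: fL; apply/andP; split; lra.
exists 0, L, f; split.
- split; last by move=> u v; rewrite !in_itv/=; exact: fI.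
  by split => //; exact: lipschitz_within_itv.
- by split => // _ [t /= + <-]; rewrite in_itv/=; exact: fG.
- by apply: (le_trans (len _ _ _ _ _)) => //; rewrite lee_fin subr0.
move=> t; rewrite in_itv/= => /andP[t0 tL].
have Gt : 0 <= bdist G (f t) by rewrite ltW// bdist_gt0//; apply: fG; rewrite t0.
have h : 2 * C * bdist G (f t) <= K * bdist G (f t) by rewrite ler_wpM2r.
rewrite ge_min; case: (fK t); first by rewrite t0.
  by move=> h1; apply/orP; left; rewrite (le_trans (len _ _ _ _ _))// lee_fin; lra.
by move=> h1; apply/orP; right; rewrite (le_trans (len _ _ _ _ _))// lee_fin; lra.
Qed.

End LoopErasure.

(** * Combining chains *)

Section Chains.
Context {R : realType} {E : normedModType R}.
Implicit Types (x y z p q : E) (G A : set E) (s : seq E) (C c r : R).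

Lemma chain_bdist G x s : boundary G !=set0 -> path (adjacent G) x s ->
  forall p, p \in x :: s -> bdist G x <= 2 ^+ size s * bdist G p.
Proof.
move=> bG; elim: s x => [|y s IH] x /=.
  by move=> _ p; rewrite inE => /eqP ->; rewrite mul1r.
move=> /andP[xy ps] p; have xy2 := adjacent_bdist bG xy.
rewrite inE => /predU1P[->|/(IH _ ps) yp].
  have [Gx _ _] := asboolP _ xy.
  have b0 : 0 <= bdist G x.
    apply: lb_le_inf => [|_ [w _ <-]//].
    by case: bG => w Gw; exists `|x - w|; exists w.
  rewrite ler_peMl// exprn_ege1//; lra.
by rewrite exprS -mulrA (le_trans xy2)// ler_pM2l.
Qed.

Lemma chain_length G x s : boundary G !=set0 -> open G -> path (adjacent G) x s ->
  polygonal_length x s <= (size s)%:R * 2 ^+ size s * bdist G x.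
Proof.
move=> bG oG; elim: s x => [|y s IH] x /=; first by rewrite !mul0r.
move=> /andP[xy ps]; have [Gx Gy xyd] := asboolP _ xy.
have xy2 := adjacent_bdist bG xy.
have yx2 : bdist G y <= 2 * bdist G x by apply: adjacent_bdist => //; rewrite adjacent_sym.
have dx := bdist_gt0 bG oG Gx.
have xyx : `|x - y| <= bdist G x.
  by apply: (le_trans xyd); case: (leP (bdist G x) (bdist G y)) => h; lra.
have p1 : 1 <= 2 ^+ size s :> R by rewrite exprn_ege1//; lra.
have h1 : (size s)%:R * 2 ^+ size s * bdist G y <= (size s)%:R * 2 ^+ size s * (2 * bdist G x).
  by rewrite ler_wpM2l// mulr_ge0// exprn_ge0.
have h2 : bdist G x <= 2 ^+ size s * bdist G x by rewrite ler_peMl// ltW.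
have := IH _ ps; rewrite -natr1 exprS; nra.
Qed.

(** The one-sided cigar condition.  It refers only to what follows a vertex, so it
    is preserved when a chain is extended at its beginning. *)
Fixpoint tail_chain G C x s : Prop :=
  if s is y :: s' then polygonal_length x s <= C * bdist G x /\ tail_chain G C y s'
  else True.

Lemma tail_chain_cat G C x s1 s2 :
  (forall p, p \in x :: s1 -> polygonal_length x (s1 ++ s2) <= C * bdist G p) ->
  tail_chain G C (last x s1) s2 -> tail_chain G C x (s1 ++ s2).
Proof.
elim: s1 x => //= y s1 IH x H ts; split; first by apply: H; rewrite inE eqxx.
apply: IH => // p ps; apply: le_trans (H p _); first by rewrite lerDr.
by rewrite inE ps orbT.
Qed.

Lemma cigar_chain_of_tail G C acc x s : boundary G !=set0 -> open G -> 0 <= C ->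
  path (adjacent G) x s -> tail_chain G C x s -> cigar_chain G (2 * C) acc x s.
Proof.
move=> bG oG C0; elim: s acc x => //= y s IH acc x /andP[xy ps] [xs ts].
split; last exact: IH.
right; apply: (le_trans xs); have [Gx _ _] := asboolP _ xy.
by rewrite ler_wpM2r; [|exact/ltW/bdist_gt0|lra].
Qed.

(** Two chains issued from the same point [z] are joined into one by reversing the
    first.  Going through a step backwards exchanges the roles of its two
    vertices, whose distances to the boundary differ at most by a factor 2. *)
Lemma cigar_chain_reverse_tail G C z s t : boundary G !=set0 -> 0 <= C ->
  path (adjacent G) z s -> tail_chain G C z s ->
  path (adjacent G) z t -> cigar_chain G (2 * C) (polygonal_length z s) z t ->
  exists t', [/\ path (adjacent G) (last z s) t', last (last z s) t' = last z t,
    cigar_chain G (2 * C) 0 (last z s) t' &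
    polygonal_length (last z s) t' = polygonal_length z s + polygonal_length z t].
Proof.
move=> bG C0; elim: s z t => [|q s IH] z t /=.
  by move=> _ _ pt ct; exists t; split => //; rewrite add0r.
move=> /andP[zq ps] [zs ts] pt ct.
have [||||t' [pt' lt' ct' lent']] := IH q (z :: t) => //.
- by rewrite /= adjacent_sym zq.
- split.
    left; rewrite distrC addrC (le_trans zs)// -mulrA mulrCA ler_wpM2l//.
    exact: adjacent_bdist.
  by rewrite distrC addrC.
by exists t'; split => //; rewrite lent' /= (distrC q) addrCA addrA.
Qed.

End Chains.

(** * The chain from a switching point to an endpoint *)

Section OneSide.
Context {R : realType} {E : normedModType R}.
Implicit Types (x y z p q : E) (G A : set E) (c r a b T : R) (g : R -> E).

(** The radius around [g a] is reached at a first time, which replaces an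
    intermediate value argument for the diameter of the initial subarcs. *)
Lemma first_exit a T r g : {within `[a, T], continuous g} -> 0 <= r ->
  (exists2 t, a <= t <= T & r <= `|g t - g a|) ->
  exists2 t0, a <= t0 <= T & r <= `|g t0 - g a| /\
    forall s, a <= s <= t0 -> `|g s - g a| <= r.
Proof.
move=> cg r0 [t1 t1i t1r].
pose S := [set t | a <= t <= T /\ r <= `|g t - g a|].
have hS : has_inf S by split; [exists t1|exists a => t [/andP[]]].
pose t0 := inf S.
have at0 : a <= t0 by apply: lb_le_inf; [exists t1|move=> t [/andP[]]].
have t01 : t0 <= t1 by apply: ge_inf; [exists a => t [/andP[]]|].
have t0i : a <= t0 <= T by rewrite at0 (le_trans t01)//; case/andP: t1i.
have below s : a <= s -> s < t0 -> `|g s - g a| < r.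
  move=> as_ st0; rewrite ltNge; apply/negP => h; have : t0 <= s.
    apply: ge_inf; first by exists a => t [/andP[]].
    by split => //; rewrite as_ (le_trans (ltW st0))//; case/andP: t0i.
  by rewrite leNgt st0.
exists t0 => //; split.
  rewrite leNgt; apply/negP => lt_r.
  have e0 : 0 < r - `|g t0 - g a| by rewrite subr_gt0.
  have [d d0 Hd] := within_itv_epsilon_delta cg t0i e0.
  have [t St td] := inf_adherent d0 hS.
  have t0t : t0 <= t by apply: ge_inf => //; exists a => u [/andP[]].
  case: St => ti tr; have := Hd t ti; rewrite ger0_norm ?subr_ge0//.
  move=> /(_ ltac:(rewrite -/t0 in td; lra)).
  have := ler_distD (g t0) (g t) (g a); lra.
move=> s /andP[as_]; rewrite le_eqVlt => /predU1P[->|st0]; last exact/ltW/below.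
move: at0; rewrite le_eqVlt => /predU1P[<-|at0]; first by rewrite subrr normr0.
rewrite leNgt; apply/negP => gt_r.
have e0 : 0 < `|g t0 - g a| - r by rewrite subr_gt0.
have [d d0 Hd] := within_itv_epsilon_delta cg t0i e0.
pose t := Num.max a (t0 - d / 2).
have ta : a <= t by rewrite /t le_max lexx.
have td : t0 - d / 2 <= t by rewrite /t le_max lexx orbT.
have tt0 : t < t0 by rewrite /t gt_max at0; lra.
have := Hd t; rewrite ltr0_norm ?subr_lt0// => /(_ _ ltac:(lra)).
rewrite ta (le_trans (ltW tt0)) => [/(_ isT)|]; last by case/andP: t0i.
have := below t ta tt0; have := ler_distD (g t) (g t0) (g a); rewrite (distrC (g t0) (g t)); lra.
Qed.

(** Induction on the number of halvings of the radius [r] of a ball around the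
    endpoint [g a] that contains the arc.  If [r] is at most half the distance from
    [g T] to the boundary, one segment reaches [g a].  Otherwise [bdist G (g T)] is
    less than [2 r].  Let [t0] be the first time at distance [r / 2] from [g a]; if
    there is none, halve [r].  The piece after [t0] has diameter at most [2 r] and
    stays at distance at least [r / (2 c)] from the boundary, so its relative size
    is at most [4 c] and it can be replaced by a chain of at most [N] steps, of
    length comparable to [r]; the piece before [t0] is treated with [r / 2].  The
    lengths form a geometric series, so the length that remains is at each vertex
    comparable to the distance from the boundary. *)
Lemma tail_chain_to_endpoint G c N g a : boundary G !=set0 -> open G -> 1 <= c ->
  (forall A x y, connected A -> A `<=` G -> A x -> A y ->
    (rdist_set G A <= (4 * c)%:E)%E ->
    exists s, [/\ (size s <= N)%N, path (adjacent G) x s & last x s = y]) ->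
  let C1 := 4 * (N%:R * 2 ^+ N) + 1 in
  forall n T r, a <= T -> {within `[a, T], continuous g} ->
    (forall t, a <= t <= T -> G (g t)) ->
    r <= 2 ^+ n * (bdist G (g a) / 3) ->
    (forall s, a <= s <= T -> `|g s - g a| <= r) ->
    (forall s t, a <= s -> s <= t -> t <= T -> `|g s - g a| <= c * bdist G (g t)) ->
    exists s, [/\ path (adjacent G) (g T) s, last (g T) s = g a,
      polygonal_length (g T) s <= C1 * r &
      tail_chain G (2 * c * 2 ^+ N * C1) (g T) s].
Proof.
move=> bG oG c1 HN C1; have N0 : 0 <= N%:R * 2 ^+ N :> R by rewrite mulr_ge0// exprn_ge0.
have C1_ge1 : 1 <= C1 by rewrite /C1; lra.
have e1 : 1 <= 2 ^+ N :> R by rewrite exprn_ege1//; lra.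
have stop T r : G (g T) -> G (g a) -> `|g T - g a| <= r -> r <= bdist G (g T) / 2 ->
    exists s, [/\ path (adjacent G) (g T) s, last (g T) s = g a,
      polygonal_length (g T) s <= C1 * r &
      tail_chain G (2 * c * 2 ^+ N * C1) (g T) s].
  move=> GT Ga Tr rd; have dT := bdist_gt0 bG oG GT.
  have n0 := normr_ge0 (g T - g a).
  have k1 : 1 <= c * (2 ^+ N * C1) by rewrite !mulr_ege1.
  exists [:: g a]; split => //=; rewrite ?andbT ?addr0.
  - apply/asboolP; split => //; apply: (le_trans Tr); apply: (le_trans rd).
    by rewrite ler_pM2r// le_max lexx.
  - by apply: (le_trans Tr); rewrite ler_peMl//; lra.
  - split => //; apply: (le_trans Tr); apply: (le_trans rd).
    rewrite mulrC ler_wpM2r ?ltW// -!mulrA; lra.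
elim=> [|n IH] T r aT cg gG rn gr gc.
all: have Ga : G (g a) by apply: gG; rewrite lexx.
all: have GT : G (g T) by apply: gG; rewrite lexx aT.
all: have da := bdist_gt0 bG oG Ga; have dT := bdist_gt0 bG oG GT.
all: have Tr : `|g T - g a| <= r by apply: gr; rewrite lexx aT.
  apply: stop => //; rewrite expr0 mul1r in rn.
  by have := bdist_lipschitz (g T) (g a) bG; lra.
have [/(stop T r GT Ga Tr)//|dr] := leP r (bdist G (g T) / 2).
have rn' : r / 2 <= 2 ^+ n * (bdist G (g a) / 3) by rewrite exprS in rn; lra.
have [ex|nex] := pselect (exists2 t, a <= t <= T & r / 2 <= `|g t - g a|); last first.
  have [|s [h1 h2 h3 h4]] := IH T (r / 2) aT cg gG rn' _ gc.
    by move=> s si; rewrite leNgt; apply/negP => h; apply: nex; exists s => //; exact: ltW.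
  exists s; split => //; apply: (le_trans h3); rewrite ler_wpM2l//; lra.
have r2 : 0 <= r / 2 by lra.
have [t0 /andP[at0 t0T] [t0r t0s]] := first_exit cg r2 ex.
have IH0 := IH t0 (r / 2) at0 _ _ rn' t0s.
have [|t ti|s t as_ st tt0|s2 [p2 l2 len2 tl2]] := IH0.
- by apply: continuous_subspaceW cg; apply: subset_itvl; rewrite bnd_simp.
- by apply: gG; case/andP: ti => -> /le_trans; exact.
- by apply: gc => //; exact: le_trans t0T.
have dlow u : t0 <= u -> u <= T -> r / 2 <= c * bdist G (g u).
  by move=> h1 h2; apply: (le_trans t0r); exact: gc.
have [|||||s1 [N1 p1 l1]] := HN (g @` `[t0, T]) (g T) (g t0).
- apply: connected_continuous_connected; first exact: segment_connected.
  by apply: continuous_subspaceW cg; apply: subset_itvr; rewrite bnd_simp.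
- move=> _ [u /= + <-]; rewrite in_itv/= => /andP[h1 h2]; apply: gG.
  by rewrite h2 andbT (le_trans at0).
- by exists T; rewrite //= in_itv/= t0T lexx.
- by exists t0; rewrite //= in_itv/= t0T lexx.
- apply: ge_ereal_sup => _ [[z w] [/= [u + <-] [v + <-]] <-] /=.
  rewrite !in_itv/= => /andP[tu uT] /andP[tv vT]; rewrite lee_fin /rdist.
  have lu := dlow u tu uT; have lv := dlow v tv vT.
  have m0 : r / 2 <= c * Num.min (bdist G (g u)) (bdist G (g v)).
    by case: (leP (bdist G (g u)) (bdist G (g v))) => h.
  have uv : `|g u - g v| <= 2 * r.
    have h1 : `|g u - g a| <= r by apply: gr; rewrite uT (le_trans at0).
    have h2 : `|g v - g a| <= r by apply: gr; rewrite vT (le_trans at0).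
    have := ler_distD (g a) (g u) (g v); rewrite (distrC (g a)); lra.
  rewrite ler_pdivrMr; first lra.
  rewrite lt_min !bdist_gt0//; apply: gG; apply/andP; split => //; lra.
have sz : 2 ^+ size s1 <= 2 ^+ N :> R by rewrite ler_weXn2l//; lra.
have len1 : polygonal_length (g T) s1 <= N%:R * 2 ^+ N * bdist G (g T).
  apply: (le_trans (chain_length bG oG p1)).
  apply: ler_wpM2r; first exact: ltW.
  by rewrite ler_pM ?ler_nat// exprn_ge0.
have len : polygonal_length (g T) (s1 ++ s2) <= C1 * r.
  rewrite polygonal_length_cat l1; apply: (le_trans (lerD len1 len2)).
  have : N%:R * 2 ^+ N * bdist G (g T) <= N%:R * 2 ^+ N * (2 * r).
    by rewrite ler_wpM2l//; lra.
  by rewrite /C1; lra.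
exists (s1 ++ s2); split => //.
- by rewrite cat_path p1 l1.
- by rewrite last_cat l1.
apply: tail_chain_cat; last by rewrite l1.
move=> p ps; apply: (le_trans len).
have h1 := chain_bdist bG p1 ps.
have dp : 0 <= bdist G p.
  have : 0 < 2 ^+ size s1 * bdist G p := lt_le_trans dT h1.
  by rewrite pmulr_rgt0 ?exprn_gt0// => /ltW.
have h2 : bdist G (g T) <= 2 ^+ N * bdist G p by apply: (le_trans h1); rewrite ler_wpM2r.
have h3 : r <= 2 * (c * (2 ^+ N * bdist G p)).
  have h4 := dlow T t0T (lexx T).
  have : c * bdist G (g T) <= c * (2 ^+ N * bdist G p) by rewrite ler_wpM2l//; lra.
  lra.
apply: (@le_trans _ _ (C1 * (2 * (c * (2 ^+ N * bdist G p))))).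
  by rewrite ler_wpM2l//; lra.
by rewrite (_ : _ * C1 * _ = C1 * (2 * (c * (2 ^+ N * bdist G p))))//; ring.
Qed.

(** The bound passes to the limit at the right endpoint, by continuity of [g] and
    of the distance to the boundary. *)
Lemma radius_bound_closed G c a T g : boundary G !=set0 -> open G -> 0 < c ->
  a <= T -> {within `[a, T], continuous g} -> (forall t, a <= t <= T -> G (g t)) ->
  (forall s t, a <= s -> s <= t -> t < T -> `|g s - g a| <= c * bdist G (g t)) ->
  forall s t, a <= s -> s <= t -> t <= T -> `|g s - g a| <= c * bdist G (g t).
Proof.
move=> bG oG c0 aT cg gG H s t as_ st; rewrite le_eqVlt => /predU1P[tT|]; last exact: H.
subst t; have dT : 0 < bdist G (g T) by apply/bdist_gt0/gG => //; rewrite aT lexx.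
move: aT; rewrite le_eqVlt => /predU1P[aT|aT].
  have -> : s = a by lra.
  by rewrite subrr normr0 mulr_ge0// ltW.
rewrite leNgt; apply/negP => gap.
pose e := (`|g s - g a| - c * bdist G (g T)) / (c + 1).
have e0 : 0 < e by rewrite /e divr_gt0//; lra.
have Ti : a <= T <= T by rewrite (ltW aT) lexx.
have [d d0 Hd] := within_itv_epsilon_delta cg Ti e0.
(* From [u] on, [g] stays within [e] of [g T]. *)
pose u := Num.max a (T - d / 2).
have ua : a <= u by rewrite /u le_max lexx.
have ud : T - d / 2 <= u by rewrite /u le_max lexx orbT.
have uT : u < T by rewrite /u gt_max aT; lra.
have near v : u <= v -> v <= T -> `|g v - g T| < e.
  by move=> uv vT; apply: Hd; [apply/andP; split; lra|rewrite ler0_norm; lra].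
(* [Num.min s v] stands in for [s], which may be [T] itself. *)
have [v [uv vT sv gsv]] : exists v, [/\ u <= v, v < T, Num.min s v <= v &
    `|g s - g (Num.min s v)| < e].
  move: st; rewrite le_eqVlt => /predU1P[->|sT].
    exists u; rewrite lexx uT (min_r (ltW uT)) lexx; split => //.
    by rewrite distrC; apply: near => //; exact: ltW.
  exists (Num.max u s); rewrite le_max lexx gt_max uT sT.
  by rewrite min_l ?subrr ?normr0 ?le_max ?lexx ?orbT.
have am : a <= Num.min s v by rewrite le_min as_ (le_trans ua).
have h1 := H _ _ am sv vT.
have h2 := ler_distD (g (Num.min s v)) (g s) (g a).
have h3 := bdist_lipschitz (g T) (g v) bG.
have h4 := near v uv (ltW vT); rewrite distrC in h4.
have h5 : c * bdist G (g v) <= c * (bdist G (g T) + e) by rewrite ler_wpM2l//; lra.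
have : e * (c + 1) = `|g s - g a| - c * bdist G (g T).
  by rewrite /e mulfVK// gt_eqF//; lra.
clearbody e; lra.
Qed.

End OneSide.

(** * Diameter and length of arcs *)

Section DiameterArcs.
Context {R : realType} {E : normedModType R}.
Implicit Types (x y : E) (G A B : set E) (a b t : R) (g : R -> E).
Local Open Scope ereal_scope.

Lemma diam_le A B : A `<=` B -> diam A <= diam B.
Proof. by move=> AB; apply: ereal_sup_le => _ [z [z1 z2] <-]; exists z => //; split; exact: AB. Qed.

Lemma dist_le_diam A x y : A x -> A y -> `|x - y|%:E <= diam A.
Proof. by move=> Ax Ay; apply: ereal_sup_ubound; exists (x, y). Qed.

Lemma diam_le_curve_length a b g : diam (g @` `[a, b]) <= curve_length a b g.
Proof.
apply: ge_ereal_sup => _ [[x y] [/= [s + <-] [t + <-]] <-] /=.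
rewrite !in_itv/= => /andP[sa sb] /andP[ta tb].
have [st|ts] := leP s t.
  by apply: le_trans (curve_length_chord g st) _; exact: curve_length_le.
rewrite distrC; apply: le_trans (curve_length_chord g (ltW ts)) _.
by apply: curve_length_le => //; exact: ltW.
Qed.

End DiameterArcs.

(** * The two implications *)

Section Switching.
Context {R : realType} {E : normedModType R}.
Implicit Types (x y : E) (G A B : set E) (a b c t : R) (g : R -> E).

(** The initial subarcs grow and the final ones shrink, so the comparison of their
    diameters changes sides once.  The switching time itself is excluded: there
    the minimum controls only one of the two sides. *)
Lemma switching_time G c a b g : boundary G !=set0 -> open G -> 0 < c -> a <= b ->
  {within `[a, b], continuous g} -> (forall t, a <= t <= b -> G (g t)) ->
  (forall t, a <= t <= b -> (mine (diam (g @` `[a, t])) (diam (g @` `[t, b]))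
     <= (c * bdist G (g t))%:E)%E) ->
  exists2 T, a <= T <= b &
    (forall s t, a <= s -> s <= t -> t < T -> `|g s - g a| <= c * bdist G (g t)) /\
    (forall s t, t <= s -> s <= b -> T < t -> `|g s - g b| <= c * bdist G (g t)).
Proof.
move=> bG oG c0 ab cg gG H.
pose Q t := (diam (g @` `[a, t]) <= diam (g @` `[t, b]))%E.
pose S := [set t | a <= t <= b /\ Q t].
have Sa : S a.
  split; first by rewrite lexx.
  apply: ge_ereal_sup => _ [[x y] [/= [s + <-] [t + <-]] <-] /=.
  rewrite !in_itv/= => /andP[h1 h2] /andP[h3 h4].
  have -> : s = a by lra.
  have -> : t = a by lra.
  by apply: dist_le_diam; exists a; rewrite //= in_itv/= lexx.
have hS : has_sup S by split; [exists a|exists b => t [/andP[]]].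
exists (sup S).
  apply/andP; split; first exact: sup_upper_bound.
  by apply: sup_le_ub; [exists a|move=> t [/andP[]]].
have im p q s : p <= s -> s <= q -> (g @` `[p, q]) (g s).
  by move=> h1 h2; exists s; rewrite //= in_itv/= h1.
split=> s t.
  move=> as_ st tT.
  have [t' [/andP[at' tb'] Qt'] tt'] : exists2 t', S t' & t < t'.
    have e0 : 0 < sup S - t by rewrite subr_gt0.
    by have [t' St'] := sup_adherent e0 hS; rewrite subKr; exists t'.
  have at_ : a <= t := le_trans as_ st.
  have Qt : Q t.
    apply: le_trans (le_trans _ Qt') _; apply: diam_le => _ [u /= + <-];
      rewrite in_itv/= => /andP[h1 h2]; apply: im => //; lra.
  have := H t; rewrite at_ (le_trans (ltW tt') tb') => /(_ isT); rewrite min_l//.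
  move=> h; rewrite -lee_fin; apply: le_trans h; apply: dist_le_diam; exact: im.
move=> ts sb Tt; have tb : t <= b := le_trans ts sb.
have at_ : a <= t by apply: le_trans (ltW Tt); exact: sup_upper_bound.
have nQ : ~~ Q t.
  apply/negP => Qt; have : t <= sup S by apply: sup_upper_bound => //; rewrite /S/= at_ tb.
  by rewrite leNgt Tt.
have := H t; rewrite at_ tb => /(_ isT); rewrite min_r; last by move: nQ; rewrite -ltNge => /ltW.
move=> h; rewrite -lee_fin; apply: le_trans h; apply: dist_le_diam; exact: im.
Qed.

(** Naturality bounds the quasihyperbolic distances in a connected set of bounded
    relative size, and hence the number of steps of chains between its points. *)
Lemma natural_domain_chain psi c G : boundary G !=set0 -> open G -> 0 <= c ->
  increasing_nonneg psi -> natural_domain psi G ->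
  exists N, forall A x y, connected A -> A `<=` G -> A x -> A y ->
    (rdist_set G A <= c%:E)%E ->
    exists s, [/\ (size s <= N)%N, path (adjacent G) x s & last x s = y].
Proof.
move=> bG oG c0 [psi0 psi_le] nat.
have b0 : 0 <= 3 * psi c by rewrite mulr_ge0// psi0.
exists (Num.bound (3 * psi c)) => A x y cA AG Ax Ay rA.
apply: chain_of_qhyp_lt => //.
have r0 : (0 <= rdist_set G A)%E.
  apply: (@le_trans _ _ (rdist G x x)%:E); last by apply: ereal_sup_ubound; exists (x, x).
  by rewrite lee_fin /rdist subrr normr0 mul0r.
have rfin : rdist_set G A \is a fin_num.
  by rewrite ge0_fin_numE//; exact: le_lt_trans rA (ltry _).
apply: (@le_lt_trans _ _ (psi c)%:E); last first.
  by rewrite lte_fin ltr_pdivlMr// mulrC archi_boundP.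
apply: (@le_trans _ _ (qhyp_set G A)); first by apply: ereal_sup_ubound; exists (x, y).
have A0 : A !=set0 by exists x.
apply: (le_trans (nat A A0 cA AG _)); first by rewrite -ge0_fin_numE.
rewrite lee_fin; apply: psi_le; first exact: fine_ge0.
by rewrite -lee_fin fineK.
Qed.

Lemma within_continuous_opp a b g : {within `[a, b], continuous g} ->
  {within `[- b, - a], continuous (g \o -%R)}.
Proof. by move=> cg; apply: within_continuous_compN; rewrite !opprK. Qed.

(** The arc given by diameter uniformity is cut at the switching time, each half is
    replaced by a chain that ends at [x] or at [y], and the two chains are joined
    and turned into an arc. *)
Lemma diameter_uniform_natural_uniform c psi G : boundary G !=set0 -> open G -> 1 <= c ->
  diameter_uniform_domain c G -> increasing_nonneg psi -> natural_domain psi G ->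
  exists c', 1 <= c' /\ uniform_domain c' G.
Proof.
move=> bG oG c1 dG ipsi nat.
have c4 : 0 <= 4 * c by lra.
have c0 : 0 < c by lra.
have [N HN] := natural_domain_chain bG oG c4 ipsi nat.
set C1 := 4 * (N%:R * 2 ^+ N) + 1 : R.
have C1_ge1 : 1 <= C1 by rewrite /C1 lerDr !mulr_ge0 ?exprn_ge0.
set C := 2 * c * 2 ^+ N * C1.
have CC1 : C1 <= C.
  have : 1 <= c * 2 ^+ N by rewrite mulr_ege1// exprn_ege1//; lra.
  by rewrite /C => h; rewrite ler_peMl//; lra.
have C0 : 0 <= C by lra.
exists (4 * C * c); split; first by nra.
move=> x y Gx Gy; have [a [b [g [[[ab cg] _] [ga gb gG] gd gm]]]] := dG x y Gx Gy.
have gG' t : a <= t <= b -> G (g t) by move=> ti; apply: gG; exists t; rewrite //= in_itv.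
have gm' t : a <= t <= b -> (mine (diam (g @` `[a, t])) (diam (g @` `[t, b]))
     <= (c * bdist G (g t))%:E)%E by move=> ti; apply: gm; rewrite in_itv.
have [T /andP[aT Tb] [H1 H2]] := switching_time bG oG c0 ab cg gG' gm'.
pose r := c * `|x - y|.
have rad s t : a <= s <= b -> a <= t <= b -> `|g s - g t| <= r.
  move=> si ti; rewrite -lee_fin; apply: le_trans gd.
  by apply: dist_le_diam; [exists s|exists t]; rewrite //= in_itv.
have ex z : G z -> exists n, r <= 2 ^+ n * (bdist G z / 3).
  move=> Gz; have d3 : 0 < bdist G z / 3 by rewrite divr_gt0// bdist_gt0.
  exists (Num.bound (r / (bdist G z / 3))); rewrite -ler_pdivrMr//.
  have r0 : 0 <= r / (bdist G z / 3) by apply: divr_ge0; [exact: mulr_ge0 (ltW c0) _|exact: ltW].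
  apply/ltW/(lt_trans (archi_boundP r0)).
  by rewrite -natrX ltr_nat ltn_expl.
have [sA [pA lA lenA tA]] : exists s, [/\ path (adjacent G) (g T) s, last (g T) s = x,
    polygonal_length (g T) s <= C1 * r & tail_chain G C (g T) s].
  have cg' : {within `[a, T], continuous g}.
    by apply: continuous_subspaceW cg; apply: subset_itvl; rewrite bnd_simp.
  have gT' t : a <= t <= T -> G (g t).
    by move=> /andP[h1 h2]; apply: gG'; rewrite h1 (le_trans h2).
  have [n rn] := ex _ Gx; rewrite -ga in rn *.
  apply: (tail_chain_to_endpoint bG oG c1 HN aT cg' gT' rn).
    by move=> s /andP[h1 h2]; apply: rad; rewrite ?lexx ?h1 ?(le_trans h2).
  exact: (radius_bound_closed bG oG c0 aT cg' gT' H1).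
have [sB [pB lB lenB tB]] : exists s, [/\ path (adjacent G) (g T) s, last (g T) s = y,
    polygonal_length (g T) s <= C1 * r & tail_chain G C (g T) s].
  have aT' : - b <= - T by rewrite lerN2.
  have cg' : {within `[- b, - T], continuous (g \o -%R)}.
    apply: within_continuous_opp.
    by apply: continuous_subspaceW cg; apply: subset_itvr; rewrite bnd_simp.
  have gT' t : - b <= t <= - T -> G ((g \o -%R) t).
    by move=> /andP[h1 h2]; apply: gG'; apply/andP; split; lra.
  have [n rn] := ex _ Gy.
  have gE : (g \o -%R) (- b) = y by rewrite /= opprK.
  rewrite -gE in rn *; rewrite (_ : g T = (g \o -%R) (- T)); last by rewrite /= opprK.
  apply: (tail_chain_to_endpoint bG oG c1 HN aT' cg' gT' rn).
    by move=> s /andP[h1 h2]; apply: rad; apply/andP; split; lra.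
  apply: (radius_bound_closed bG oG c0 aT' cg' gT') => s t h1 h2 h3 /=.
  by rewrite opprK; apply: H2; lra.
have cB := cigar_chain_of_tail (polygonal_length (g T) sA) bG oG C0 pB tB.
have [s [ps ls cs lens]] := cigar_chain_reverse_tail bG C0 pA tA pB cB.
rewrite lA in ps ls cs lens; rewrite lB in ls.
have C20 : 0 <= 2 * C by lra.
have K2 : 2 * (2 * C) <= 4 * C * c by nra.
have := uniform_arc_of_cigar_chain bG oG C20 Gx ps cs K2.
rewrite ls => -[a' [b' [g' [h1 h2 h3 h4]]]]; exists a', b', g'; split => //.
apply: (le_trans h3); rewrite lee_fin lens; apply: (le_trans (lerD lenA lenB)).
have r0 : 0 <= r by rewrite mulr_ge0// ltW.
have : C1 * r <= C * r by rewrite ler_wpM2r.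
have : 0 <= C * r by rewrite mulr_ge0.
by rewrite -mulrA -/r; lra.
Qed.

Lemma uniform_diameter_uniform c G : uniform_domain c G -> diameter_uniform_domain c G.
Proof.
move=> uG x y Gx Gy; have [a [b [g [h1 h2 h3 h4]]]] := uG x y Gx Gy.
exists a, b, g; split => //; first exact: le_trans (diam_le_curve_length _ _ _) h3.
move=> t tab; apply: le_trans (h4 t tab).
by rewrite le_min !ge_min !diam_le_curve_length orbT.
Qed.

(** A point that is close to an endpoint, compared with the distance from that
    endpoint to the boundary, is far from the boundary because [bdist] is
    Lipschitz; otherwise the cigar condition applies. *)
Lemma uniform_bdist_lower c G a b g t : boundary G !=set0 -> open G -> 1 <= c ->
  (forall s, a <= s <= b -> G (g s)) -> a <= t <= b ->
  (mine (curve_length a t g) (curve_length t b g) <= (c * bdist G (g t))%:E)%E ->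
  Num.min (bdist G (g a)) (bdist G (g b)) <= 2 * c * bdist G (g t).
Proof.
move=> bG oG c1 gG ti; have /andP[at_ tb] := ti.
have dt := bdist_gt0 bG oG (gG t ti).
have k : bdist G (g t) <= c * bdist G (g t) by rewrite ler_peMl// ltW.
rewrite ge_min => /orP[] h; rewrite ge_min; apply/orP; [left|right].
  have := le_trans (curve_length_chord g at_) h; rewrite lee_fin distrC => h'.
  by have := bdist_lipschitz (g t) (g a) bG; lra.
have := le_trans (curve_length_chord g tb) h; rewrite lee_fin => h'.
by have := bdist_lipschitz (g t) (g b) bG; lra.
Qed.

(** The quasihyperbolic length of a uniform arc is estimated by its length
    [c * |x - y|] times the bound [2 c / min (bdist x) (bdist y)] for
    the integrand.  The resulting bound is linear in [rdist]. *)
Lemma uniform_qhyp_le c G x y : boundary G !=set0 -> open G -> 1 <= c ->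
  uniform_domain c G -> G x -> G y ->
  (qhyp G x y <= (2 * c ^+ 2 * rdist G x y)%:E)%E.
Proof.
move=> bG oG c1 uG Gx Gy.
have [a [b [g [[cg _] jg lg mg]]]] := uG x y Gx Gy.
have [ga gb gG] := jg; have ab : a <= b by case: cg.
have rg : rectifiable a b g := le_lt_trans lg (ltry _).
have gG' t : a <= t <= b -> G (g t) by move=> ti; apply: gG; exists t; rewrite //= in_itv.
have m0 : 0 < Num.min (bdist G x) (bdist G y) by rewrite lt_min !bdist_gt0.
set m := Num.min _ _ in m0 *.
apply: (@le_trans _ _ (line_integral a b g (fun z => (bdist G z)^-1%R))).
  by apply: ereal_inf_lbound; exists a, b, g.
apply: (le_trans (line_integral_inv_bdist_le (K := 2 * c / m) bG oG cg rg gG _)).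
  move=> t ti; have dt := bdist_gt0 bG oG (gG' t ti).
  have := @uniform_bdist_lower c G a b g t bG oG c1 gG' ti.
  rewrite ga gb -/m mg ?in_itv// => /(_ isT) h.
  by rewrite -div1r ler_pdivrMr// mulrAC ler_pdivlMr// mul1r.
have lfin : curve_length a b g \is a fin_num by rewrite ge0_fin_numE// curve_length_ge0.
rewrite lee_fin; apply: (@le_trans _ _ (2 * c / m * (c * `|x - y|))).
  apply: ler_wpM2l; first by rewrite divr_ge0// ?ltW//; lra.
  by rewrite -lee_fin fineK.
by rewrite /rdist -/m le_eqVlt; apply/orP; left; apply/eqP; field; rewrite gt_eqF.
Qed.

Lemma uniform_natural c G : boundary G !=set0 -> open G -> 1 <= c ->
  uniform_domain c G -> natural_domain (fun t => 2 * c ^+ 2 * t) G.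
Proof.
move=> bG oG c1 uG A [x0 Ax0] cA AG rA.
have c2 : 0 <= 2 * c ^+ 2 by rewrite mulr_ge0// sqr_ge0.
have r0 : (0 <= rdist_set G A)%E.
  apply: (@le_trans _ _ (rdist G x0 x0)%:E); last by apply: ereal_sup_ubound; exists (x0, x0).
  by rewrite lee_fin /rdist subrr normr0 mul0r.
have rfin : rdist_set G A \is a fin_num by rewrite ge0_fin_numE.
apply: ge_ereal_sup => _ [[x y] [/= Ax Ay] <-] /=.
apply: (le_trans (uniform_qhyp_le bG oG c1 uG (AG _ Ax) (AG _ Ay))).
rewrite lee_fin ler_wpM2l// -lee_fin fineK//.
by apply: ereal_sup_ubound; exists (x, y).
Qed.

End Switching.

Theorem theorem1p2 (R : realType) (E : completeNormedModType R)
    (hE : dim_ge2 E) (G : set E) (hG : is_domain G) (hGE : G `<` [set: E]) :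
  (exists c : R, 1 <= c /\ uniform_domain c G) <->
  ((exists c1 : R, 1 <= c1 /\ diameter_uniform_domain c1 G) /\
   (exists psi : R -> R, increasing_nonneg psi /\ natural_domain psi G)).
Proof.
have [G0 _ oG] := hG; have bG := boundary_neq0 G0 oG hGE.
split=> [[c [c1 uG]]|[[c1 [c11 dG]] [psi [ipsi nG]]]].
  split; first by exists c; split => //; exact: uniform_diameter_uniform.
  exists (fun t => 2 * c ^+ 2 * t); split; last exact: uniform_natural.
  have c2 : 0 <= 2 * c ^+ 2 by rewrite mulr_ge0// sqr_ge0.
  by split=> [t t0|s t s0 st]; [exact: mulr_ge0|exact: ler_wpM2l].
exact: diameter_uniform_natural_uniform dG ipsi nG.
Qed.
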